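(* Let $(X,r)$ be a solution. Its structure group $G_{(X,r)}$ is (1) virtually $\mathbb{Z}^{K_r}$ (that is, it has a finite-index subgroup isomorphic to $\mathbb{Z}^{K_r}$), where $K_r$ is the number of orbits of the structure rack $(X,\triangleleft_r)$; (2) linear; (3) residually finite.
   Context: A solution $(X,r)$ is a finite set $X$ with a bijection $r\colon X\times X\to X\times X$, $r(x,y)=(\sigma_x(y),\tau_y(x))$, satisfying the Yang--Baxter equation $r_1r_2r_1=r_2r_1r_2$ on $X^3$ ($r_1=r\times \mathrm{Id}_X$, $r_2=\mathrm{Id}_X\times r$), with all maps $\sigma_x,\tau_x\colon X\to X$ bijective. Its structure group is $G_{(X,r)}=\langle X \mid xy=\sigma_x(y)\tau_y(x),\ x,y\in X\rangle$. Its structure rack is $(X,\triangleleft_r)$ with $x\triangleleft_r y=\tau_y\sigma_{\tau_x^{-1}(y)}(x)$; its orbits are the orbits of $X$ under the permutations $x\mapsto x\triangleleft_r y$, $y\in X$. A group is linear if it has a faithful finite-dimensional linear representation over a field. *)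

(* Defs.v *)
From HB Require Import structures.
From mathcomp Require Import all_boot all_fingroup all_algebra.
From mathcomp Require Import boolp classical_sets functions cardinality.

Set Implicit Arguments.
Unset Strict Implicit.
Unset Printing Implicit Defensive.

Import GroupScope GRing.Theory.

Local Open Scope quotient_scope.

(* A word is a list of letters: (x, true) stands for x, (x, false) for x^-1. *)
Notation word X := (seq (X * bool)).

Section Presentation.
Variables (X : choiceType) (R : word X -> word X -> Prop).

Inductive pres_cong : word X -> word X -> Prop :=
| PresRel u v : R u v -> pres_cong u v
| PresCancel x b : pres_cong [:: (x, b); (x, ~~ b)] [::]
| PresRefl u : pres_cong u u
| PresSym u v : pres_cong u v -> pres_cong v u
| PresTrans u v w : pres_cong u v -> pres_cong v w -> pres_cong u w
| PresCat u u' v v' :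
    pres_cong u u' -> pres_cong v v' -> pres_cong (u ++ v) (u' ++ v').

Definition pres_rel : rel (word X) := fun u v => `[< pres_cong u v >].

Fact pres_rel_refl : reflexive pres_rel.
Proof. by move=> u; apply/asboolP/PresRefl. Qed.

Fact pres_rel_sym : symmetric pres_rel.
Proof. by move=> u v; apply/asboolP/asboolP => /PresSym. Qed.

Fact pres_rel_trans : transitive pres_rel.
Proof.
by move=> v u w /asboolP uv /asboolP vw; apply/asboolP/(PresTrans uv vw).
Qed.

Canonical pres_equiv :=
  EquivRel pres_rel pres_rel_refl pres_rel_sym pres_rel_trans.

(* The group < X | u = v for all u, v such that R u v >. *)
Definition pres_group := {eq_quot pres_equiv}.

HB.instance Definition _ := Choice.on pres_group.

Definition pres_class (w : word X) : pres_group := \pi_{eq_quot pres_equiv} w.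

Lemma pres_classP u v : reflect (pres_class u = pres_class v) (pres_rel u v).
Proof. exact: (iffP (eqmodP _ _ _)). Qed.

(* Qualified, since fingroup also has a repr, picking an element of a set. *)
Definition pres_repr (a : pres_group) : word X :=
  @generic_quotient.repr _ {eq_quot pres_equiv} a.

Lemma pres_class_repr (a : pres_group) : pres_class (pres_repr a) = a.
Proof. exact: reprK. Qed.

Lemma pres_class_ind (P : pres_group -> Prop) :
  (forall w, P (pres_class w)) -> forall a, P a.
Proof. by move=> Pw a; rewrite -(pres_class_repr a). Qed.

Definition word_inv (w : word X) : word X :=
  rev [seq (a.1, ~~ a.2) | a <- w].

Definition pres_one : pres_group := pres_class [::].

Definition pres_mul (a b : pres_group) : pres_group :=
  pres_class (pres_repr a ++ pres_repr b).

Definition pres_inv (a : pres_group) : pres_group :=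
  pres_class (word_inv (pres_repr a)).

Lemma word_invK : involutive word_inv.
Proof.
move=> w; rewrite /word_inv map_rev revK -map_comp -[RHS]map_id.
by apply: eq_map => -[x b] /=; rewrite negbK.
Qed.

Lemma pres_cong_mulV w : pres_cong (w ++ word_inv w) [::].
Proof.
elim: w => [|[x b] w IHw]; first exact: PresRefl.
rewrite /word_inv /= rev_cons -cats1 catA.
apply: (PresTrans _ (PresCancel x b)).
rewrite -[[:: (x, b); _]]/([:: (x, b)] ++ [:: (x, ~~ b)]) -cat_cons.
apply: PresCat; last exact: PresRefl.
by rewrite -cat1s -[in X in pres_cong _ X](cats0 [:: (x, b)]);
  apply: PresCat; first exact: PresRefl.
Qed.

Lemma pres_cong_mulVw w : pres_cong (word_inv w ++ w) [::].
Proof. by rewrite -[X in _ ++ X]word_invK; apply: pres_cong_mulV. Qed.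

Lemma pres_cong_inv u v : pres_cong u v -> pres_cong (word_inv u) (word_inv v).
Proof.
move=> uv; apply: (@PresTrans _ (word_inv u ++ (v ++ word_inv v))).
  rewrite -[X in pres_cong X _]cats0.
  by apply: PresCat; [exact: PresRefl | exact/PresSym/pres_cong_mulV].
rewrite catA -[X in pres_cong _ X]cat0s.
apply: PresCat; last exact: PresRefl.
apply: PresTrans (pres_cong_mulVw u).
by apply: PresCat; [exact: PresRefl | exact: PresSym].
Qed.

Lemma pres_cong_repr w : pres_cong (pres_repr (pres_class w)) w.
Proof. by apply/asboolP/pres_classP; rewrite pres_class_repr. Qed.

Lemma pres_mulE u v :
  pres_mul (pres_class u) (pres_class v) = pres_class (u ++ v).
Proof. by apply/pres_classP/asboolP; apply: PresCat; exact: pres_cong_repr. Qed.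

Lemma pres_invE u : pres_inv (pres_class u) = pres_class (word_inv u).
Proof. by apply/pres_classP/asboolP/pres_cong_inv/pres_cong_repr. Qed.

Fact pres_mulA : associative pres_mul.
Proof.
elim/pres_class_ind=> u; elim/pres_class_ind=> v; elim/pres_class_ind=> w.
by rewrite !pres_mulE catA.
Qed.

Fact pres_mul1 : left_id pres_one pres_mul.
Proof. by elim/pres_class_ind=> u; rewrite pres_mulE. Qed.

Fact pres_mulr1 : right_id pres_one pres_mul.
Proof. by elim/pres_class_ind=> u; rewrite pres_mulE cats0. Qed.

Fact pres_mulV : left_inverse pres_one pres_inv pres_mul.
Proof.
elim/pres_class_ind=> u; rewrite pres_invE pres_mulE.
exact/pres_classP/asboolP/pres_cong_mulVw.
Qed.

Fact pres_mulrV : right_inverse pres_one pres_inv pres_mul.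
Proof.
elim/pres_class_ind=> u; rewrite pres_invE pres_mulE.
exact/pres_classP/asboolP/pres_cong_mulV.
Qed.

HB.instance Definition _ := isGroup.Build pres_group
  pres_mulA pres_mul1 pres_mulr1 pres_mulV pres_mulrV.

End Presentation.

Section Solutions.
Variables (X : finType) (r : X * X -> X * X).

Definition sigma (x y : X) : X := (r (x, y)).1.

(* Beware of the order of the arguments: r (x, y) = (sigma x y, tau y x). *)
Definition tau (y x : X) : X := (r (x, y)).2.

Definition r1 (t : X * X * X) : X * X * X := (r t.1, t.2).

Definition r2 (t : X * X * X) : X * X * X :=
  let p := r (t.1.2, t.2) in (t.1.1, p.1, p.2).

Record is_solution : Prop := IsSolution {
  sol_bij : bijective r;
  sol_ybe : r1 \o r2 \o r1 =1 r2 \o r1 \o r2;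
  sol_sigma_bij : forall x, bijective (sigma x);
  sol_tau_bij : forall y, bijective (tau y)
}.

Definition structure_rel (u v : word X) : Prop :=
  exists x y, u = [:: (x, true); (y, true)] /\
              v = [:: (sigma x y, true); (tau y x, true)].

Definition structure_group := pres_group structure_rel.

HB.instance Definition _ := Group.on structure_group.

(* finv (tau x) is the inverse of tau x, as X is finite and tau x injective. *)
Definition rack_op (x y : X) : X := tau y (sigma (finv (tau x) y) x).

Fact rack_op_inj (hr : is_solution) y : injective (rack_op^~ y).
Proof.
move=> x x' /(bij_inj (sol_tau_bij hr y)) eq_sigma.
have rE z : r (finv (tau z) y, z) = (sigma (finv (tau z) y) z, y).
  rewrite [LHS]surjective_pairing -/(sigma _ _) -/(tau _ _).
  by rewrite f_finv //; exact: bij_inj (sol_tau_bij hr z).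
have: r (finv (tau x) y, x) = r (finv (tau x') y, x') by rewrite !rE eq_sigma.
by move/(bij_inj (sol_bij hr)) => -[].
Qed.

Definition rack_perm (hr : is_solution) (y : X) : {perm X} :=
  perm (rack_op_inj hr (y := y)).

Definition rack_orbits (hr : is_solution) : {set {set X}} :=
  [set orbit 'P <<[set rack_perm hr y | y : X]>> x | x : X].

End Solutions.

Section GroupProperties.
Local Open Scope classical_set_scope.

Definition is_subgroup (G : groupType) (H : set G) : Prop :=
  [/\ H 1, forall x y, H x -> H y -> H (x * y) & forall x, H x -> H x^-1].

Definition finite_index (G : groupType) (H : set G) : Prop :=
  finite_set (range (fun g : G => [set g * h | h in H])).

Definition virtually_Zn (G : groupType) (n : nat) : Prop :=
  exists H : set G, [/\ is_subgroup H, finite_index H &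
    exists f : 'rV[int]_n -> G,
      {morph f : u v / (u + v)%R >-> u * v} /\ set_bij [set: 'rV[int]_n] H f].

Definition is_linear_group (G : groupType) : Prop :=
  exists (F : fieldType) (n : nat) (rho : G -> 'M[F]_n),
    [/\ rho 1 = 1%:M%R, {morph rho : g h / g * h >-> (g *m h)%R}
      & injective rho].

Definition residually_finite (G : groupType) : Prop :=
  forall g : G, g != 1 ->
    exists (Q : finGroupType) (f : {multiplicative G -> Q}), f g != 1.

End GroupProperties.

(* Main.v *)
Require Import Defs.
From HB Require Import structures.
From mathcomp Require Import all_boot all_fingroup all_algebra.
From mathcomp Require Import boolp classical_sets functions cardinality.
From mathcomp Require Import zify.

(** Write G for the structure group, x ◁ y for the rack operation. The relation
xy = sigma_x(y) tau_y(x) makes x |-> tau_x a right action of G on X, and by the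
Yang-Baxter equation each tau_z is an automorphism of the rack. The rack has
its own structure group, in which y x = (x ◁ y) y, and the guitar map is a
bijective cocycle from G to that group. Here the rack group is never formed;
what is kept of it is its left multiplication, transported to G: the map
[guitar x] sends g to the product of the generator (x acted upon by g^-1) with
g, and these maps satisfy guitar y o guitar x = guitar (x ◁ y) o guitar y
([guitar_rack]). Applied to 1, their composites give all positive words.

Take N a multiple of the orders of all the right translations of the rack. Then
the N-th iterate of guitar x commutes with every guitar z. If N is also chosen
so that h_x, the value at 1 of this iterate, acts trivially on X, then right
multiplication by h_x commutes with every guitar z as well. It follows that the
h_x commute with each other ([guitar_power_comm]) and that h_x depends only on
the rack orbit of x ([guitar_power_orbit]). That h_x acts trivially for a
suitable N rests on one property of the solution: the map sending a to the c
such that tau_a(c) = a is injective ([tau_fixpoint_inj]).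

Let A be the subgroup generated by the h_x, one for each of the K orbits.
- A is isomorphic to Z^K. The map sending x to (tau_x, indicator of the orbit of
  x) extends to a homomorphism from G to the wreath product of Z by Sym(X), and
  it sends h_x to N times the indicator of the orbit of x
  ([degree_guitar_power]), so the h_x are independent.
- A has finite index, by the argument of Dietzmann's lemma. A positive word in
  the guitar maps which is longer than |X| N contains some x at least N times;
  the occurrences of x can be moved to the front, and their product is a factor
  h_x ([guitar_shorten]). So the positive words lie in finitely many cosets of
  A, and the pigeonhole principle extends this to all of G
  ([left_stable_mulVg]).

Linearity and residual finiteness hold for every virtually Z^n group G. The
action of G on the cosets of the subgroup embeds G into the wreath product of
Z^n by a finite symmetric group ([wreath_embedding]). A wreath product of V by
Sym(T) acts on the functions from T to V by permuting the arguments and adding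
a function. Embedding Z^n into the additive group of a field turns this action
into a faithful representation by affine matrices; reducing the coefficients
modulo an integer gives finite quotients that separate the points. *)

Set Implicit Arguments.
Unset Strict Implicit.
Unset Printing Implicit Defensive.

Import GroupScope GRing.Theory.

(** * Morphisms and integer powers in groups *)

Lemma morphg1 (G K : groupType) (phi : G -> K) :
  {morph phi : x y / x * y} -> phi 1 = 1.
Proof. by move=> phiM; apply: (mulgI (phi 1)); rewrite -phiM !mulg1. Qed.

Lemma morphgV (G K : groupType) (phi : G -> K) :
  {morph phi : x y / x * y} -> {morph phi : x / x^-1}.
Proof.
move=> phiM x; apply: (mulgI (phi x)).
by rewrite -phiM !mulgV (morphg1 phiM).
Qed.

Lemma additive_morphg1 (V : zmodType) (G : groupType) (f : V -> G) :
  {morph f : u v / (u + v)%R >-> u * v} -> f 0%R = 1.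
Proof. by move=> fM; apply: (mulgI (f 0%R)); rewrite -fM addr0 mulg1. Qed.

Lemma additive_morphgN (V : zmodType) (G : groupType) (f : V -> G) :
    {morph f : u v / (u + v)%R >-> u * v} ->
  {morph f : u / (- u)%R >-> u^-1}.
Proof.
move=> fM u; apply: (mulgI (f u)).
by rewrite -fM subrr mulgV additive_morphg1.
Qed.

Section IntegerPowers.
Variable G : groupType.
Implicit Types (g h : G) (m n : int).

Definition expgz g m : G :=
  match m with Posz k => g ^+ k | Negz k => g ^- k.+1 end.

(** Integer exponents are determined by the exponent 1 + m, which reduces the
additivity of the exponent to an induction. *)
Lemma expgzS g m : expgz g (1 + m)%R = g * expgz g m.
Proof.
case: m => [k | [|k]]; first by rewrite /= expgS.
  by rewrite /= expg1 mulgV.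
have -> : (1 + Negz k.+1 = Negz k)%R by rewrite !NegzE; lia.
by rewrite /= (expgSr _ k.+1) invgM mulVKg.
Qed.

Lemma expgzD g m n : expgz g (m + n)%R = expgz g m * expgz g n.
Proof.
elim/int_rect: m n => [|k IHk|k IHk] n; first by rewrite add0r mul1g.
  by rewrite -add1n PoszD -addrA !expgzS IHk mulgA.
apply: (mulgI g); rewrite mulgA -!expgzS.
have -> : (1 + - (k.+1)%:Z = - k%:Z :> int)%R by rewrite -add1n PoszD; lia.
by rewrite -IHk; congr (expgz g _); rewrite -add1n PoszD; lia.
Qed.

Lemma commute_expgz g h m n : commute g h -> commute (expgz g m) (expgz h n).
Proof.
move=> gh; have commX x y (l : int) : commute x y -> commute x (expgz y l).
  by case: l => l xy /=; [|apply: commuteV]; apply: commuteX.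
by apply/commX/commute_sym/commX/commute_sym.
Qed.

End IntegerPowers.

Lemma expgz_morph (G K : groupType) (phi : G -> K) g m :
  {morph phi : x y / x * y} -> phi (expgz g m) = expgz (phi g) m.
Proof.
move=> phiM; have phiX k : phi (g ^+ k) = phi g ^+ k.
  by elim: k => [|k IHk]; rewrite ?morphg1 // !expgS phiM IHk.
by case: m => k /=; rewrite ?(morphgV phiM) phiX.
Qed.

(** * Groups given by a presentation *)

Section PresentedGroup.
Variables (X : choiceType) (R : word X -> word X -> Prop).
Implicit Types (x : X) (u v : word X) (g : pres_group R).

Definition pres_gen x : pres_group R := pres_class R [:: (x, true)].

Lemma pres_class_cons x b u :
  pres_class R ((x, b) :: u)
    = (if b then pres_gen x else (pres_gen x)^-1) * pres_class R u.
Proof.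
have mE v w : pres_class R v * pres_class R w = pres_class R (v ++ w).
  exact: pres_mulE.
have VE : (pres_gen x)^-1 = pres_class R [:: (x, false)].
  exact: pres_invE.
by case: b; rewrite ?VE /pres_gen mE.
Qed.

Lemma pres_group_ind (P : pres_group R -> Prop) :
    P 1 -> (forall x g, P g -> P (pres_gen x * g)) ->
    (forall x g, P g -> P ((pres_gen x)^-1 * g)) ->
  forall g, P g.
Proof.
move=> P1 PM PV; apply: pres_class_ind; elim=> [|[x b] u IHu] //.
by rewrite pres_class_cons; case: b; [apply: PM | apply: PV].
Qed.

Section Lift.
Variables (K : groupType) (phi : X -> K).

Definition word_eval u : K :=
  foldr (fun a k => (if a.2 then phi a.1 else (phi a.1)^-1) * k) 1 u.

Lemma word_eval_cat u v : word_eval (u ++ v) = word_eval u * word_eval v.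
Proof. by elim: u => [|a u IHu] /=; rewrite ?mul1g // IHu mulgA. Qed.

Hypothesis phiR : forall u v, R u v -> word_eval u = word_eval v.

Lemma word_eval_cong u v : pres_cong R u v -> word_eval u = word_eval v.
Proof.
elim=> {u v} [u v /phiR // | x b | // | // | u v w _ -> // |].
  by case: b; rewrite /= mulg1 (mulgV, mulVg).
by move=> u u' v v' _ Eu _ Ev; rewrite !word_eval_cat Eu Ev.
Qed.

(** The universal property of a presentation: a map on the letters that
respects the relations extends to the group. *)
Definition pres_lift g : K := word_eval (pres_repr g).

Lemma pres_lift_class u : pres_lift (pres_class R u) = word_eval u.
Proof. exact/word_eval_cong/pres_cong_repr. Qed.

Lemma pres_lift_gen x : pres_lift (pres_gen x) = phi x.
Proof. by rewrite pres_lift_class /= mulg1. Qed.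

Lemma pres_liftM : {morph pres_lift : g h / g * h}.
Proof.
elim/pres_class_ind=> u; elim/pres_class_ind=> v.
by rewrite [_ * _]pres_mulE !pres_lift_class word_eval_cat.
Qed.

End Lift.

End PresentedGroup.

(** * Permutational wreath products *)

(** The pair (p, u) is to be read as the affine map f |-> f o p^-1 + u on the
functions from T to V, and the product as composition, the left factor acting
first, as for permutations. *)
Definition wreath (V : zmodType) (T : finType) : Type :=
  ({perm T} * {ffun T -> V})%type.

Section Wreath.
Variables (V : zmodType) (T : finType).
Local Notation W := (wreath V T).
Implicit Types a b c : W.

HB.instance Definition _ := Choice.on W.

Definition wreath_one : W := (1, 0%R).
Definition wreath_mul a b : W :=
  (a.1 * b.1, [ffun j => a.2 (b.1^-1%g j) + b.2 j]%R).
Definition wreath_inv a : W := (a.1^-1, [ffun j => - a.2 (a.1 j)]%R).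

Fact wreath_mulA : associative wreath_mul.
Proof.
move=> a b c; congr (_, _); rewrite /= ?mulgA //.
by apply/ffunP=> j; rewrite !ffunE /= invMg permM addrA.
Qed.

Fact wreath_mul1 : left_id wreath_one wreath_mul.
Proof.
by case=> p u; congr (_, _) => /=; rewrite ?mul1g //; apply/ffunP=> j;
  rewrite !ffunE add0r.
Qed.

Fact wreath_mulr1 : right_id wreath_one wreath_mul.
Proof.
by case=> p u; congr (_, _) => /=; rewrite ?mulg1 //; apply/ffunP=> j;
  rewrite !ffunE /= invg1 perm1 addr0.
Qed.

Fact wreath_mulV : left_inverse wreath_one wreath_inv wreath_mul.
Proof.
move=> a; congr (_, _); rewrite /= ?mulVg //; apply/ffunP=> j.
by rewrite !ffunE /= permKV addNr.
Qed.

Fact wreath_mulrV : right_inverse wreath_one wreath_inv wreath_mul.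
Proof.
move=> a; congr (_, _); rewrite /= ?mulgV //; apply/ffunP=> j.
by rewrite !ffunE /= invgK subrr.
Qed.

HB.instance Definition _ := isGroup.Build W
  wreath_mulA wreath_mul1 wreath_mulr1 wreath_mulV wreath_mulrV.
End Wreath.

HB.instance Definition _ (V : finZmodType) (T : finType) :=
  Finite.on (wreath V T).

Section WreathBase.
Variables (V : zmodType) (T : finType).
Implicit Types u w : {ffun T -> V}.

(** The normal subgroup of the translations. *)
Definition wreath_base u : wreath V T := (1, u).

Lemma wreath_baseD : {morph wreath_base : u w / (u + w)%R >-> u * w}.
Proof.
move=> u w; congr (_, _); first by rewrite mulg1.
by apply/ffunP=> j; rewrite !ffunE /= invg1 perm1.
Qed.

Lemma wreath_base_expgz u m : expgz (wreath_base u) m = wreath_base (u *~ m)%R.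
Proof.
have expE k : wreath_base u ^+ k = wreath_base (u *+ k)%R.
  by elim: k => [|k IHk] //; rewrite expgS mulrS wreath_baseD IHk.
case: m => k /=; rewrite expE // NegzE mulrNz.
by rewrite (additive_morphgN wreath_baseD).
Qed.

End WreathBase.

Section WreathRepresentation.
Local Open Scope ring_scope.
Variables (V : zmodType) (T : finType).
Variables (F : fieldType) (iota : {additive V -> F}).
Implicit Types a b : wreath V T.

(** The affine map of a, as a matrix acting on row vectors (1, f). *)
Definition wreath_mx a : 'M[F]_(1 + #|T|) :=
  block_mx 1%:M (\row_j iota (a.2 (enum_val j)))
           0 (\matrix_(i, j) (a.1 (enum_val i) == enum_val j)%:R).

Lemma wreath_mx1 : wreath_mx 1%g = 1%:M.
Proof.
rewrite (@scalar_mx_block _ 1 #|T|) /wreath_mx; congr block_mx.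
  by apply/matrixP=> i j; rewrite !mxE ffunE raddf0.
by apply/matrixP=> i j; rewrite !mxE perm1 (inj_eq enum_val_inj).
Qed.

Lemma wreath_mxM : {morph wreath_mx : a b / (a * b)%g >-> a *m b}.
Proof.
move=> a b; rewrite [RHS](@mulmx_block _ 1 _ 1 _ 1); congr block_mx.
- by rewrite mulmx0 mul1mx addr0.
- apply/matrixP=> i j; rewrite mul1mx !mxE ffunE raddfD addrC; congr (_ + _).
  rewrite (bigD1 (enum_rank (b.1^-1%g (enum_val j)))) //= !mxE enum_rankK.
  rewrite permKV eqxx mulr1 big1 ?addr0 // => k.
  rewrite !mxE; case: (_ =P enum_val j) => [<-|]; rewrite ?mulr0 //.
  by rewrite permK enum_valK eqxx.
- by rewrite mul0mx mulmx0 addr0.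
- apply/matrixP=> i j; rewrite mul0mx add0r !mxE.
  rewrite (bigD1 (enum_rank (a.1 (enum_val i)))) //= !mxE enum_rankK.
  rewrite permM eqxx mul1r big1 ?addr0 // => k.
  rewrite !mxE; case: (_ =P enum_val k) => [->|]; rewrite ?mul0r //.
  by rewrite enum_valK eqxx.
Qed.

Lemma wreath_mx_inj : injective iota -> injective wreath_mx.
Proof.
move=> iota_inj [p u] [q w] /(@eq_block_mx _ 1 _ 1) [_ eq_row _ eq_perm].
congr (_, _).
  apply/permP=> x; move/matrixP/(_ (enum_rank x) (enum_rank (p x))): eq_perm.
  rewrite !mxE !enum_rankK eqxx /=; case: eqP => // _ /esym/eqP.
  by rewrite (eq_sym 0) oner_eq0.
apply/ffunP=> x; apply: iota_inj.
by move/rowP/(_ (enum_rank x)): eq_row; rewrite !mxE !enum_rankK.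
Qed.

End WreathRepresentation.

Definition wreath_map (V W : zmodType) (T : finType) (h : V -> W)
    (a : wreath V T) : wreath W T :=
  (a.1, [ffun j => h (a.2 j)]).

Lemma wreath_mapM (V W : zmodType) (T : finType) (h : V -> W) :
    {morph h : u v / (u + v)%R} ->
  {morph @wreath_map V W T h : a b / a * b}.
Proof.
move=> hD a b; congr (_, _); apply/ffunP=> j.
by rewrite !ffunE hD.
Qed.

(** A free abelian group of any finite rank embeds in the additive group of the
one field Q(t), as the integer polynomials in t of bounded degree, so that a
coefficient in Z^n takes up a single matrix entry. *)
Lemma rV_field_embedding (n : nat) :
  exists (F : fieldType) (iota : {additive 'rV[int]_n -> F}), injective iota.
Proof.
exists {fraction {poly int}}, (@tofrac _ \o @rVpoly int n)%R => u v /= /eqP.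
by rewrite tofrac_eq => /eqP /(can_inj rVpolyK).
Qed.

(** * Virtually free abelian groups *)

Lemma int_mod_neq0 (z : int) : z != 0%R -> exists m, (z%:~R != 0 :> 'Z_m)%R.
Proof.
have natP n : (0 < n)%N -> (n%:R != 0 :> 'Z_n.+1)%R.
  by move=> n_gt0; rewrite -val_eqE /= val_Zp_nat // modn_small // -lt0n.
case: z => n z_neq0; first by exists n.+1; apply: natP; rewrite lt0n.
by exists n.+2; rewrite NegzE mulrNz oppr_eq0; apply: (natP n.+1).
Qed.

Section VirtuallyAbelian.
Variables (G : groupType) (V : zmodType) (H : set G) (f : V -> G).
Hypotheses (finH : finite_index H) (fM : {morph f : u v / (u + v)%R >-> u * v}).
Hypothesis fH : set_bij [set: V]%classic H f.

(** Choosing representatives of the finitely many left cosets of H identifies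
G, as a right V-set, with C * V: the element g gets the coordinates
(cl g, v g). *)
Lemma coset_coordinates : exists (C : finType) (cl : G -> C) (rep : C -> G)
    (v : G -> V),
  [/\ forall g, g = rep (cl g) * f (v g), cancel rep cl
    & forall g u, cl (g * f u) = cl g].
Proof.
case: fH => f_fun f_inj f_surj.
pose coset g : set G := [set g * h | h in H]%classic.
have cosetM g u : coset (g * f u) = coset g.
  apply/seteqP; split=> x [h Hh <-]; have [w _ Ew] := f_surj _ Hh.
    by exists (f (u + w)%R); [apply: f_fun | rewrite -Ew fM mulgA].
  exists (f (- u + w)%R); first exact: f_fun.
  by rewrite fM (additive_morphgN fM) -Ew mulgA mulgK.
have /finite_seqP[s Es] := finH.
have memP g : coset g \in s.
  by have: (range coset) (coset g); [exists g | rewrite Es].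
pose cl g : seq_sub s := SeqSub (memP g).
have repP (c : seq_sub s) : exists g, cl g = c.
  have: (range coset) (val c) by rewrite Es; apply: valP.
  by case=> g _ Eg; exists g; apply: val_inj.
have [rep repK] := choice repP.
have vP g : exists u, g = rep (cl g) * f u.
  have /(congr1 val) /= Ecl := repK (cl g).
  have: coset g g.
    by exists 1; rewrite ?mulg1 // -(additive_morphg1 fM); apply: f_fun.
  by rewrite -Ecl => -[h /f_surj[u _ <-] Eg]; exists u; rewrite Eg.
have [v vK] := choice vP.
exists (seq_sub s), cl, rep, v; split=> // g u.
by apply: val_inj; apply: cosetM.
Qed.

(** Left translation by g^-1 commutes with the right action of V on G = C * V,
so it is given by a permutation p of C and, for each coset, a translation of V.
The inverse turns the left action into a right one, in accordance with the
order of composition of permutations. *)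
Lemma wreath_embedding : exists (C : finType) (phi : G -> wreath V C),
  {morph phi : g h / g * h} /\ injective phi.
Proof.
have [C [cl [rep [v [repvK repK clM]]]]] := coset_coordinates.
have f_inj : injective f.
  by case: fH => _ f_inj _ u w; apply: f_inj; rewrite inE.
have vE c u : v (rep c * f u) = u.
  apply/f_inj/(mulgI (rep c)); rewrite [RHS]repvK.
  by rewrite clM repK.
have vM g u : v (g * f u) = (v g + u)%R.
  by rewrite {1}(repvK g) -mulgA -fM vE.
have clE g h : cl (g * rep (cl h)) = cl (g * h).
  by rewrite [in RHS](repvK h) mulgA clM.
pose s g c := cl (g^-1 * rep c).
have sK g : cancel (s g) (s g^-1).
  by move=> c; rewrite /s clE invgK mulVKg repK.
pose p g := perm (can_inj (sK g)).
have pE g c : p g c = cl (g^-1 * rep c) by rewrite permE.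
exists C, (fun g => (p g, [ffun c => v (g^-1 * rep ((p g)^-1 c))])).
have pM g h : p (g * h) = p g * p h.
  by apply/permP=> c; rewrite permM !pE clE invgM mulgA.
split=> [g h | g h [eq_p /ffunP eq_u]].
  congr (_, _); first exact: pM.
  apply/ffunP=> d; have [c ->] : exists c, d = p h (p g c).
    by exists ((p g)^-1 ((p h)^-1 d)); rewrite !permKV.
  have -> : p h (p g c) = p (g * h) c by rewrite pM permM.
  rewrite !ffunE /= permK pM permM !permK pE invgM -mulgA.
  by rewrite {1}(repvK (g^-1 * rep c)) mulgA vM addrC.
pose c := cl 1; apply/invg_inj/(mulIg (rep c)).
rewrite (repvK (g^-1 * _)) (repvK (h^-1 * _)) -!pE eq_p.
by have := eq_u (p h c); rewrite !ffunE eq_p permK => ->.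
Qed.

End VirtuallyAbelian.

Lemma virtually_Zn_linear (G : groupType) n :
  virtually_Zn G n -> is_linear_group G.
Proof.
case=> H [_ finH [f [fM fH]]].
have [C [phi [phiM phi_inj]]] := wreath_embedding finH fM fH.
have [F [iota iota_inj]] := rV_field_embedding n.
exists F, (1 + #|C|)%N, (wreath_mx iota \o phi).
have phi1 := morphg1 phiM.
split=> [|g h|]; rewrite /= ?phi1 ?wreath_mx1 ?phiM ?wreath_mxM //.
exact: inj_comp (wreath_mx_inj iota_inj) phi_inj.
Qed.

(** A nontrivial element of the wreath product is detected by its permutation,
or else by a nonzero integer coordinate, which survives modulo some m. *)
Lemma virtually_Zn_residually_finite (G : groupType) n :
  virtually_Zn G n -> residually_finite G.
Proof.
case=> H [_ finH [f [fM fH]]] g g_neq1.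
have [C [phi [phiM phi_inj]]] := wreath_embedding finH fM fH.
have phi1 := morphg1 phiM.
have morphP (Q : finGroupType) (psi : G -> Q) :
    {morph psi : a b / a * b} -> psi g != 1 ->
  exists (Q : finGroupType) (psi : {multiplicative G -> Q}), psi g != 1.
  move=> psiM psig.
  by exists Q, (HB.pack_for {multiplicative G -> Q} psi
                  (isMultiplicative.Build _ _ psi psiM)).
have [p1 | ] := eqVneq (phi g).1 1; last first.
  apply: (morphP {perm C} (fun g => (phi g).1)) => a b.
  by rewrite phiM.
have [c u_neq0] : exists c, (phi g).2 c != 0%R.
  apply/existsP; apply: contraNT g_neq1 => /existsPn u0.
  apply/eqP/phi_inj; rewrite phi1 [phi g]surjective_pairing p1; congr (_, _).
  by apply/ffunP=> c; have := u0 c; rewrite negbK ffunE => /eqP.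
have [k uk_neq0] : exists k, (phi g).2 c 0%R k != 0%R.
  apply/existsP; apply: contraNT u_neq0 => /existsPn u0.
  by apply/eqP/rowP=> k; have := u0 k; rewrite negbK mxE => /eqP.
have [m mP] := int_mod_neq0 uk_neq0.
pose h (u : 'rV[int]_n) : 'Z_m := (u 0 k)%:~R%R.
apply: (morphP (wreath 'Z_m C) (wreath_map h \o phi)) => [a b | /=].
  by rewrite /= phiM wreath_mapM // => u w; rewrite /h mxE rmorphD.
apply: contra mP => /eqP[_ /ffunP/(_ c)].
by rewrite !ffunE => /eqP.
Qed.

(** * The structure rack and the degree homomorphism *)

Section Solution.
Variables (X : finType) (r : X * X -> X * X) (hr : is_solution r).
Local Notation G := (pres_group (structure_rel r)).
Local Notation gen := (pres_gen (structure_rel r)).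
Local Notation sigma := (sigma r).
Local Notation tau := (tau r).
Local Notation "x ◁ y" := (rack_op r x y) (at level 40, left associativity).
Implicit Types (x y z a b c : X) (g h : G) (w : seq X).

Let rE x y : r (x, y) = (sigma x y, tau y x).
Proof. exact: surjective_pairing. Qed.

Lemma tau_inj y : injective (tau y).
Proof. exact: bij_inj (sol_tau_bij hr y). Qed.

Lemma ybe_projections x y z :
  tau (sigma (tau y x) z) (sigma x y) = sigma (tau (sigma y z) x) (tau z y) /\
  tau z (tau y x) = tau (tau z y) (tau (sigma y z) x).
Proof.
by have := sol_ybe hr (x, y, z); rewrite /r1 /r2 /=; do !rewrite rE /=; case.
Qed.

Lemma ybe_middle x y z :
  tau (sigma (tau y x) z) (sigma x y) = sigma (tau (sigma y z) x) (tau z y).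
Proof. by case: (ybe_projections x y z). Qed.

Lemma ybe_tau x y z : tau z (tau y x) = tau (tau z y) (tau (sigma y z) x).
Proof. by case: (ybe_projections x y z). Qed.

(** The form in which the rack operation is used: if ax = by in the structure
group, with y = tau_x(a) and b = sigma_a(x), then x ◁ y = tau_y(b). Every pair
x, y is of this form, by [tau_surj]. *)
Lemma rack_op_tau a x : x ◁ tau x a = tau (tau x a) (sigma a x).
Proof. by rewrite /rack_op finv_f //; apply: tau_inj. Qed.

Lemma tau_surj y x : exists a, x = tau y a.
Proof. by exists (finv (tau y) x); rewrite f_finv //; apply: tau_inj. Qed.

Lemma tau_rack z x y : tau z (x ◁ y) = tau z x ◁ tau z y.
Proof.
have [a ->] := tau_surj x y.
by rewrite [in RHS]ybe_tau !rack_op_tau -ybe_middle -!ybe_tau.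
Qed.

(** For given a, let U(a) be the c such that tau_a(c) = a. Given d, choose e
such that sigma_d(e) = d and put a = tau_e(d). The relation de = da of the
structure group shows that e and a act in the same way on X. So tau_a(d) =
tau_e(d) = a, that is, U(a) = d. Hence U is onto, and it is injective as X is
finite. *)
Lemma tau_fixpoint_inj a b c : tau a c = a -> tau b c = b -> a = b.
Proof.
pose U d := finv (tau d) d.
pose V d := tau (finv (sigma d) d) d.
have UE d e : tau d e = d -> U d = e.
  by move=> E; rewrite /U -[in X in finv _ X]E finv_f //; apply: tau_inj.
have VK : cancel V U.
  move=> d; apply: UE; rewrite /V; set e := finv _ d.
  have sde : sigma d e = d.
    by rewrite f_finv //; apply: bij_inj (sol_sigma_bij hr d).
  suffices eq_tau x : tau e x = tau (tau e d) x by rewrite -eq_tau.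
  by have [y ->] := tau_surj d x; rewrite [LHS]ybe_tau sde.
have UK : cancel U V by apply/(bij_can_sym (injF_bij (can_inj VK))).
by move=> /UE Ua /UE Ub; apply: (can_inj UK); rewrite Ua Ub.
Qed.

Definition tau_perm y : {perm X} := perm (tau_inj (y := y)).

Lemma tau_permM x y :
  tau_perm x * tau_perm y = tau_perm (sigma x y) * tau_perm (tau y x).
Proof. by apply/permP=> z; rewrite !permM !permE ybe_tau. Qed.

Let Inn := <<[set rack_perm hr y | y : X]>>.

Definition orbit_indicator x : {ffun X -> int} :=
  [ffun z => (z \in orbit 'P Inn x)%:R%R].

Definition rack_automorphic (p : {perm X}) :=
  forall x y, p (x ◁ y) = p x ◁ p y.

Lemma rack_automorphicM p q :
  rack_automorphic p -> rack_automorphic q -> rack_automorphic (p * q).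
Proof. by move=> pA qA x y; rewrite !permM pA qA. Qed.

Lemma rack_automorphicV p : rack_automorphic p -> rack_automorphic p^-1.
Proof. by move=> pA x y; apply: (@perm_inj _ p); rewrite pA !permKV. Qed.

(** A rack automorphism normalizes the group generated by the translations, so
it permutes the orbits. *)
Lemma orbit_indicator_automorphic p x z : rack_automorphic p ->
  orbit_indicator (p x) (p z) = orbit_indicator x z.
Proof.
move=> pA; rewrite !ffunE -[p x]/('P%act x p) -[p z]/('P%act z p).
suffices {1}-> : Inn = Inn :^ p by rewrite orbit_conjsg.
have sub q : rack_automorphic q -> Inn \subset Inn :^ q.
  move=> qA; rewrite -genJ; apply: genS.
  apply/fintype.subsetP=> _ /imsetP[y _ ->].
  apply/imsetP; exists (rack_perm hr (q^-1 y)); first exact: imset_f.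
  apply/permP=> d; rewrite -[d](permKV q) permJ.
  by rewrite [rack_perm hr y _]permE [rack_perm hr _ _]permE qA !permKV.
apply/eqP; rewrite finset.eqEsubset sub // sub_conjg sub //.
exact: rack_automorphicV.
Qed.

Lemma rack_orbit_op x y : x ◁ y \in orbit 'P Inn x.
Proof.
apply/orbitP; exists (rack_perm hr y); last by rewrite /= apermE permE.
exact/mem_gen/imset_f.
Qed.

Lemma orbit_indicator_op x y : orbit_indicator (x ◁ y) = orbit_indicator x.
Proof.
apply/ffunP=> z; rewrite !ffunE; congr (_ : bool)%:R%R.
by have /orbit_eqP -> := rack_orbit_op x y.
Qed.

Lemma tau_perm_automorphic y : rack_automorphic (tau_perm y).
Proof. by move=> a b; rewrite !permE tau_rack. Qed.

(** The first component makes the structure group act on X; the second counts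
the letters orbit by orbit, and this count has to be twisted because the action
may permute the rack orbits. *)
Definition gen_degree x : wreath int X := (tau_perm x, orbit_indicator x).

Lemma gen_degree_rel (u v : word X) :
  structure_rel r u v -> word_eval gen_degree u = word_eval gen_degree v.
Proof.
case=> x [y [-> ->]] /=; rewrite !mulg1.
congr (_, _); first exact: tau_permM.
have indM a b z : orbit_indicator a ((tau_perm b)^-1 z)
    = orbit_indicator (tau b a) z.
  by rewrite -(orbit_indicator_automorphic _ _ (tau_perm_automorphic b))
    permKV permE.
apply/ffunP=> z; rewrite [LHS]ffunE [RHS]ffunE /= !indM addrC; congr (_ + _)%R.
by rewrite -rack_op_tau orbit_indicator_op.
Qed.

Definition degree g : wreath int X := pres_lift gen_degree g.

Lemma degreeM : {morph degree : g h / g * h}.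
Proof. exact: pres_liftM gen_degree_rel. Qed.

Lemma degree1 : degree 1 = 1.
Proof. exact: morphg1 degreeM. Qed.

Definition rho g : {perm X} := (degree g).1.

Lemma rhoM g h : rho (g * h) = rho g * rho h.
Proof. by rewrite /rho degreeM. Qed.

Lemma rho1 : rho 1 = 1.
Proof. by rewrite /rho degree1. Qed.

Lemma degree_gen x : degree (gen x) = gen_degree x.
Proof. exact: pres_lift_gen gen_degree_rel _. Qed.

Lemma rho_gen x : rho (gen x) = tau_perm x.
Proof. by rewrite /rho degree_gen. Qed.

Lemma rhoV g : rho g^-1 = (rho g)^-1.
Proof. exact: (morphgV rhoM). Qed.

Lemma rho_automorphic g : rack_automorphic (rho g).
Proof.
elim/pres_group_ind: g => [|x g IHg|x g IHg].
- by move=> x y; rewrite rho1 !perm1.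
- rewrite rhoM rho_gen.
  exact: rack_automorphicM (tau_perm_automorphic x) IHg.
- rewrite rhoM rhoV rho_gen; apply: rack_automorphicM IHg.
  exact/rack_automorphicV/tau_perm_automorphic.
Qed.

Lemma gen_rel a x : gen a * gen x = gen (sigma a x) * gen (tau x a).
Proof.
rewrite /pres_gen ![_ * _]pres_mulE; apply/pres_classP/asboolP/PresRel.
by exists a, x.
Qed.

(** * The action of the rack on the structure group *)

(** Left multiplication by x in the structure group of the rack, read through
the guitar map, which is the cocycle J with J(gh) = J(g)^h J(h) and J(x) = x: it
satisfies J (guitar x g) = x J(g). *)
Definition guitar x g : G := gen ((rho g)^-1 x) * g.

(** The defining relation y x = (x ◁ y) y of the structure group of the rack. *)
Lemma guitar_rack x y g : guitar y (guitar x g) = guitar (x ◁ y) (guitar y g).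
Proof.
rewrite /guitar !rhoM !rho_gen !invMg !permM.
rewrite (rack_automorphicV (rho_automorphic g)).
move: ((rho g)^-1 x) ((rho g)^-1 y) => a b; have [c ->] := tau_surj a b.
have tauV z d : (tau_perm z)^-1 (tau z d) = d.
  by apply: (@perm_inj _ (tau_perm z)); rewrite permKV permE.
by rewrite rack_op_tau !tauV !mulgA gen_rel.
Qed.

Lemma guitar_mulr x g h : rho h = 1 -> guitar x (g * h) = guitar x g * h.
Proof. by move=> rh; rewrite /guitar rhoM rh mulg1 mulgA. Qed.

(** The effect of guitar x on the permutation by which an element acts on X. *)
Definition guitar_perm_fun x (p : {perm X}) := tau_perm (p^-1 x) * p.

(** If s is the image of p and a = p^-1(x), then s sends to x the point c such
that tau_a(c) = a. So s determines c, hence a by [tau_fixpoint_inj], hence p. *)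
Lemma guitar_perm_inj x : injective (guitar_perm_fun x).
Proof.
move=> p q; rewrite /guitar_perm_fun.
set a := p^-1 x; set b := q^-1 x => eq_pq.
suffices eq_ab : a = b by move: eq_pq; rewrite eq_ab => /mulgI.
pose c := (tau_perm a)^-1 a.
have tac : tau a c = a by rewrite -(permE (tau_inj (y := a))) permKV.
apply: (tau_fixpoint_inj tac); apply: (@perm_inj _ q).
rewrite -(permE (tau_inj (y := b))) -permM -eq_pq permM permE tac.
by rewrite !permKV.
Qed.

Lemma rho_guitar x g n :
  rho (iter n (guitar x) g) = (perm (@guitar_perm_inj x) ^+ n) (rho g).
Proof.
elim: n => [|n IHn]; first by rewrite expg0 perm1.
by rewrite expgSr permM -IHn iterS rhoM rho_gen permE.
Qed.

(** Two factors for two purposes: the period kills the translations of the rack,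
which are permutations of X, and the maps [guitar_perm_fun x], which are
permutations of the permutations of X. *)
Definition period := (#|{perm X}| * #|{perm {perm X}}|)%N.

Lemma period_gt0 : (0 < period)%N.
Proof.
by rewrite /period muln_gt0 -!cardsT; apply/andP; split; apply: cardG_gt0.
Qed.

Lemma expg_period (T : finType) (p : {perm T}) :
  #|{perm T}| %| period -> p ^+ period = 1.
Proof.
move=> dvd; have /dvdnP[k ->] : #[p] %| period.
  by apply: dvdn_trans dvd; rewrite -cardsT /order cardSg ?finset.subsetT.
by rewrite mulnC expgM expg_order expg1n.
Qed.

Definition guitar_power x : G := iter period (guitar x) 1.

Lemma rho_guitar_power x : rho (guitar_power x) = 1.
Proof.
by rewrite rho_guitar expg_period ?dvdn_mull // perm1 rho1.
Qed.

Lemma iter_guitar_mulr x g h n : rho h = 1 ->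
  iter n (guitar x) (g * h) = iter n (guitar x) g * h.
Proof. by move=> rh; elim: n => //= n ->; rewrite guitar_mulr. Qed.

Lemma iter_guitar_rack n x z g :
  iter n (guitar x) (guitar z g)
    = guitar ((rack_perm hr x ^+ n) z) (iter n (guitar x) g).
Proof.
elim: n => [|n IHn]; first by rewrite expg0 perm1.
by rewrite /= IHn guitar_rack expgSr permM permE.
Qed.

(** In the structure group of the rack, the power x^period is central. *)
Lemma iter_period_guitar x z g :
  iter period (guitar x) (guitar z g) = guitar z (iter period (guitar x) g).
Proof.
by rewrite iter_guitar_rack expg_period ?dvdn_mulr // perm1.
Qed.

(** Both sides arise from computing iter period (guitar x) (guitar_power y) in
two ways: by commuting guitar x with right multiplication by guitar_power y, and
by commuting it with the maps guitar y. *)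
Lemma guitar_power_comm x y : commute (guitar_power x) (guitar_power y).
Proof.
have comm n : iter period (guitar x) (iter n (guitar y) 1)
    = iter n (guitar y) (guitar_power x).
  by elim: n => //= n IHn; rewrite iter_period_guitar IHn.
have:= comm period; rewrite -/(guitar_power y).
rewrite -[guitar_power y in LHS]mul1g -[guitar_power x in RHS]mul1g.
by rewrite !iter_guitar_mulr ?rho_guitar_power.
Qed.

(** By [guitar_rack], guitar y conjugates guitar x to guitar (x ◁ y); but it
also commutes with the iterates that define the powers. *)
Lemma guitar_power_op x y : guitar_power (x ◁ y) = guitar_power x.
Proof.
have iterE n g :
    iter n (guitar (x ◁ y)) (guitar y g) = guitar y (iter n (guitar x) g).
  by elim: n => //= n ->; rewrite -guitar_rack.
have := iterE period 1.
rewrite iter_period_guitar -/(guitar_power _) -/(guitar_power x).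
rewrite -[guitar_power _ in LHS]mul1g -[guitar_power x in RHS]mul1g.
by rewrite !guitar_mulr ?rho_guitar_power // => /mulgI.
Qed.

Lemma guitar_power_orbit x y : y \in orbit 'P Inn x ->
  guitar_power y = guitar_power x.
Proof.
case/orbitP=> p p_Inn <-; rewrite /= apermE.
pose S := [set q : {perm X} | [forall z, guitar_power (q z) == guitar_power z]].
have S_group : group_set S.
  apply/group_setP; split=> [|q s].
    by rewrite inE; apply/forallP=> z; rewrite perm1.
  rewrite !inE => /forallP qP /forallP sP; apply/forallP=> z.
  by rewrite permM (eqP (sP _)) qP.
have : p \in Group S_group.
  apply: fintype.subsetP p_Inn; rewrite gen_subG.
  apply/fintype.subsetP=> _ /imsetP[z _ ->]; rewrite inE; apply/forallP=> d.
  by rewrite permE guitar_power_op.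
by rewrite inE => /forallP/(_ x)/eqP.
Qed.

Lemma degree_guitar x g j :
  (degree (guitar x g)).2 j = (orbit_indicator x j + (degree g).2 j)%R.
Proof.
rewrite degreeM degree_gen [LHS]ffunE; congr (_ + _)%R.
exact/orbit_indicator_automorphic/rack_automorphicV/rho_automorphic.
Qed.

Lemma degree_guitar_power x :
  degree (guitar_power x) = (1, (orbit_indicator x *+ period)%R).
Proof.
rewrite [LHS]surjective_pairing; congr (_, _); first exact: rho_guitar_power.
rewrite /guitar_power; elim: period => [|n IHn].
  by rewrite degree1 mulr0n.
apply/ffunP=> j; rewrite /= degree_guitar IHn mulrS.
by rewrite [RHS]ffunE.
Qed.

(** Collecting letters on the left: an x is moved to the left past y by turning
y into the letter that x translates to y, so the length does not change. *)
Lemma guitar_extract w x n g : (n <= count_mem x w)%N ->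
  exists2 w', size w = (n + size w')%N &
    foldr guitar g w = iter n (guitar x) (foldr guitar g w').
Proof.
elim: w n => [|y w IHw] [|n] //=; try by exists (y :: w); rewrite ?add0n.
  by exists [::].
have [-> | neq_yx] := eqVneq y x; rewrite ?add0n ?add1n ?ltnS => le_n.
  have [w' Ew ->] := IHw _ le_n; exists w'; rewrite ?Ew //.
have [w' Ew ->] := IHw _ le_n; exists ((rack_perm hr x ^+ n.+1)^-1 y :: w').
  by rewrite Ew addnS.
by rewrite [RHS](iter_guitar_rack n.+1) permKV.
Qed.

Lemma foldr_guitar_power w x :
  foldr guitar (guitar_power x) w = foldr guitar 1 w * guitar_power x.
Proof.
elim: w => [|y w IHw] /=; rewrite ?mul1g // IHw guitar_mulr //.
exact: rho_guitar_power.
Qed.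

Lemma guitar_shorten w : (#|X| * period < size w)%N ->
  exists w' x, (size w' < size w)%N /\
    foldr guitar 1 w = foldr guitar 1 w' * guitar_power x.
Proof.
have sizeE : size w = (\sum_x count_mem x w)%N.
  elim: w => [|y w IHw] /=; first by rewrite big1.
  rewrite big_split /= -IHw (bigD1 y) //= eqxx big1 ?addn0 ?add1n // => x.
  by rewrite eq_sym => /negPf->.
move=> w_long; have [x le_x] : exists x, (period <= count_mem x w)%N.
  apply/existsP; apply: contraTT w_long => /existsPn lt_w.
  rewrite -leqNgt sizeE -sum_nat_const; apply: leq_sum => x _.
  by have := lt_w x; rewrite -ltnNge => /ltnW.
have [w' Ew ->] := guitar_extract 1 le_x; exists w', x; split.
  by rewrite Ew -[ltnLHS]add0n ltn_add2r period_gt0.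
rewrite -foldr_guitar_power; elim: w' {Ew} => //= y w' <-.
by rewrite iter_period_guitar.
Qed.

End Solution.

(** * A free abelian subgroup of finite index *)

(** If the union of the cosets c(w)A is stable under left multiplication by g,
two of the translates g^n c(w)a lie in the same coset, whence some positive
power g^(d+1) fixes the coset of c(w). Then g^-1 acts on it as g^d does. *)
Lemma left_stable_mulVg (G : groupType) (W : finType) (c : W -> G)
    (A : set G) (g : G) : is_subgroup A ->
    (forall w a, A a -> exists w' a', A a' /\ g * (c w * a) = c w' * a') ->
  forall w a, A a -> exists w' a', A a' /\ g^-1 * (c w * a) = c w' * a'.
Proof.
move=> [A1 AM AV] g_stable w a Aa.
have /choice[s sP] (n : nat) : exists wa : W * G,
    A wa.2 /\ g ^+ n * (c w * a) = c wa.1 * wa.2.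
  elim: n => [|n [[w' a'] /= [Aa' E]]]; first by exists (w, a); rewrite mul1g.
  have [w1 [a1 [Aa1 E1]]] := g_stable w' a' Aa'.
  by exists (w1, a1); rewrite expgS -mulgA E E1.
have [n [d eq_s]] : exists n d, (s n).1 = (s (n + d.+1)%N).1.
  have /injectivePn[i [j]] : ~~ injectiveb (fun i : 'I_#|W|.+1 => (s i).1).
    by apply/negP=> /injectiveP/leq_card; rewrite card_ord ltnn.
  wlog ltij : i j / (i < j)%N.
    move=> H; rewrite neq_ltn => /orP[lt_ij|lt_ji] E.
      by apply: H E => //; rewrite neq_ltn lt_ij.
    by apply: (H _ _ lt_ji); rewrite // neq_ltn lt_ji.
  by exists i, (j - i.+1)%N; rewrite addnS -addSn subnKC.
have [An En] := sP n; have [Am Em] := sP (n + d.+1)%N.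
have [Ad Ed] := sP d.
pose b := (s n).2^-1 * (s (n + d.+1)%N).2.
have Ab : A b by apply: (AM _ _ (AV _ An) Am).
have gb : g ^+ d.+1 * (c w * a) = c w * a * b.
  apply: (mulgI (g ^+ n)); rewrite mulgA -expgnDr Em -eq_s [RHS]mulgA En.
  by rewrite /b -mulgA mulVKg.
exists (s d).1, ((s d).2 * b^-1); split; first exact: AM Ad (AV _ Ab).
apply: (mulgI g); rewrite mulVKg !mulgA -[g * _ * _]mulgA -Ed mulgA -expgS.
by rewrite gb mulgK.
Qed.

Section FreeAbelianSubgroup.
Variables (X : finType) (r : X * X -> X * X) (hr : is_solution r).
Local Notation G := (pres_group (structure_rel r)).
Local Notation K := #|rack_orbits hr|.
Local Notation Inn := <<[set rack_perm hr y | y : X]>>.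
Implicit Types (v u : 'rV[int]_K).

Lemma orbit_rep_exists (k : 'I_K) : exists x, enum_val k == orbit 'P Inn x.
Proof. by have /imsetP[x _ ->] := enum_valP k; exists x. Qed.

Definition orbit_rep (k : 'I_K) : X := xchoose (orbit_rep_exists k).

Lemma orbit_repE k : enum_val k = orbit 'P Inn (orbit_rep k).
Proof. exact/eqP/(xchooseP (orbit_rep_exists k)). Qed.

Lemma orbit_rep_in j k :
  (orbit_rep j \in orbit 'P Inn (orbit_rep k)) = (j == k).
Proof.
apply/orbit_eqP/eqP => [|-> //]; rewrite -!orbit_repE; exact: enum_val_inj.
Qed.

Definition power_prod v : G :=
  \prod_(k < K) expgz (guitar_power hr (orbit_rep k)) (v 0%R k).

Lemma power_prodD : {morph power_prod : u v / (u + v)%R >-> u * v}.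
Proof.
move=> u v; rewrite -prodgM_commute => [|i j _ _].
  by apply: eq_bigr => k _; rewrite mxE expgzD.
exact/commute_expgz/guitar_power_comm.
Qed.

Lemma degree_power_prod v : degree hr (power_prod v) = wreath_base
  (\sum_(k < K) orbit_indicator hr (orbit_rep k) *+ period X *~ v 0 k)%R.
Proof.
rewrite (big_morph _ (degreeM hr) (degree1 hr)).
rewrite (big_morph _ (@wreath_baseD _ _) (erefl _)); apply: eq_bigr => k _.
by rewrite (expgz_morph _ _ (degreeM hr)) degree_guitar_power wreath_base_expgz.
Qed.

(** The orbit representatives serve as dual coordinates: evaluation at the j-th
one recovers the j-th exponent, up to the factor period. *)
Lemma degree_power_prodE v j :
  (degree hr (power_prod v)).2 (orbit_rep j) = (v 0 j *+ period X)%R.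
Proof.
rewrite degree_power_prod sum_ffunE (bigD1 j) //= big1 => [|k neq_kj].
  rewrite addr0 ffunMzE ffunMnE ffunE orbit_rep_in eqxx.
  by rewrite -mulrzr intz mulr_natl.
rewrite ffunMzE ffunMnE ffunE orbit_rep_in eq_sym (negPf neq_kj).
by rewrite mul0rn mul0rz.
Qed.

Lemma power_prod_inj : injective power_prod.
Proof.
move=> u v eq_uv; apply/rowP=> j.
have := degree_power_prodE u j; rewrite eq_uv degree_power_prodE.
by move/eqP; rewrite Num.Theory.eqrMn2r eqn0Ngt period_gt0 => /eqP.
Qed.

Lemma guitar_power_in_prod x : exists v, guitar_power hr x = power_prod v.
Proof.
have x_orb : orbit 'P Inn x \in rack_orbits hr by apply: imset_f.
pose k := enum_rank_in x_orb (orbit 'P Inn x).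
exists (delta_mx 0 k)%R; rewrite /power_prod (big_only1 k) // => [|j neq_jk _].
  rewrite mxE !eqxx /= expg1; apply/esym/guitar_power_orbit.
  by apply/orbit_eqP; rewrite -orbit_repE enum_rankK_in.
by rewrite mxE (negPf neq_jk).
Qed.

Definition power_subgroup : set G := range power_prod.

Lemma power_subgroupP : is_subgroup power_subgroup.
Proof.
split=> [|_ _ [u _ <-] [v _ <-]|_ [u _ <-]].
- by exists 0%R; rewrite ?(additive_morphg1 power_prodD).
- by exists (u + v)%R; rewrite ?power_prodD.
- by exists (- u)%R; rewrite ?(additive_morphgN power_prodD).
Qed.

Lemma guitar_word_reduction (w : seq X) :
  exists w' : {bseq #|X| * period X of X}, exists2 a, power_subgroup a &
    foldr (guitar hr) 1 w = foldr (guitar hr) 1 w' * a.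
Proof.
have [A1 AM _] := power_subgroupP.
have [n] := ubnP (size w); elim: n w => // n IHn w /ltnSE le_n.
have [le_w | ] := leqP (size w) (#|X| * period X); last first.
  case/(guitar_shorten hr)=> w' [x [lt_w ->]].
  have [w1 [a Aa ->]] := IHn w' (leq_trans lt_w le_n).
  have [v ->] := guitar_power_in_prod x.
  exists w1, (a * power_prod v); rewrite ?mulgA //.
  by apply: AM => //; exists v.
by exists (Bseq le_w), 1; rewrite ?mulg1.
Qed.

(** Left multiplication by a generator prolongs a guitar word by one letter, as
guitar x is left multiplication by a generator that runs over all of X. *)
Lemma power_subgroup_cosets g : exists w : {bseq #|X| * period X of X},
  exists2 a, power_subgroup a & g = foldr (guitar hr) 1 w * a.
Proof.
have [A1 AM AV] := power_subgroupP.
pose c (w : {bseq #|X| * period X of X}) := foldr (guitar hr) 1 w.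
have gen_stable x w a : power_subgroup a -> exists w' a',
    power_subgroup a' /\ pres_gen _ x * (c w * a) = c w' * a'.
  move=> Aa; have [w' [b Ab E]] := guitar_word_reduction (rho hr (c w) x :: w).
  exists w', (b * a); split; first exact: AM.
  by rewrite !mulgA -E /= /guitar permK.
suffices [w [a [Aa ->]]] : exists w a, power_subgroup a /\ g = c w * a.
  by exists w, a.
elim/pres_group_ind: g => [|x g [w [a [Aa ->]]]|x g [w [a [Aa ->]]]].
- by exists [bseq], 1; rewrite mulg1.
- exact: gen_stable.
- exact: left_stable_mulVg power_subgroupP (gen_stable x) _ _ Aa.
Qed.

Lemma power_subgroup_finite_index : finite_index power_subgroup.
Proof.
have [A1 AM AV] := power_subgroupP.
pose coset g : set G := [set g * h | h in power_subgroup]%classic.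
pose c (w : {bseq #|X| * period X of X}) := coset (foldr (guitar hr) 1 w).
apply: (@sub_finite_set _ _ (range c)); last exact/finite_image/finite_finset.
move=> _ [g _ <-]; have [w [a Aa ->]] := power_subgroup_cosets g.
exists w => //; apply/seteqP; split=> _ [h Ah <-].
  by exists (a^-1 * h); [apply: AM => //; apply: AV | rewrite mulgA mulgK].
by exists (a * h); rewrite ?mulgA //; apply: AM.
Qed.

End FreeAbelianSubgroup.

Theorem corollary6p2 (X : finType) (r : X * X -> X * X) (hr : is_solution r) :
  [/\ virtually_Zn (structure_group r) #|rack_orbits hr|,
      is_linear_group (structure_group r)
    & residually_finite (structure_group r)].
Proof.
have vZ : virtually_Zn (structure_group r) #|rack_orbits hr|.
  exists (power_subgroup hr); split; first exact: power_subgroupP.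
    exact: power_subgroup_finite_index.
  exists (@power_prod X r hr); split; first exact: power_prodD.
  by split=> [u _ | u v _ _ /power_prod_inj // | //]; exists u.
split=> //; first exact: virtually_Zn_linear vZ.
exact: virtually_Zn_residually_finite vZ.
Qed.
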